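(* Let $d\ge1$ and let $\mathcal D_f$ be an $f$-divergence on the set $\mathcal P$ of Borel probability measures on $\mathbb R^d$. Fix $m\in\mathbb R^d$ and let $\mathbb P\in\mathcal P_1$ be even symmetric about $m$. Let $\mathbb Q_0\in\mathcal P_1$ be even symmetric about $0$, and let $\mathcal Q=\{\mathbb Q_{\nu,S}\mid \nu\in\mathbb R^d,\ S\in\mathcal S_{++}^d\}$ be the location--scale family generated by $\mathbb Q_0$. If $(\nu,S)\mapsto\mathcal D_f(\mathbb P\|\mathbb Q_{\nu,S})$ has a unique minimiser $(\nu^\star,S^\star)$ over $\mathbb R^d\times\mathcal S_{++}^d$, then $$\mu(\mathbb Q_{\nu^\star,S^\star})=\mu(\mathbb P)=m.$$
   Context: $\mathcal P_1\subseteq\mathcal P$ is the set of probability measures with finite first moment; for $\pi\in\mathcal P_1$, $\mu(\pi):=\int_{\mathbb R^d}x\,d\pi(x)$ is the mean. $\mathcal S_{++}^d$ is the set of real (symmetric) positive-definite $d\times d$ matrices. **Even symmetry.** $\pi\in\mathcal P$ is even symmetric about $a\in\mathbb R^d$ if $\pi(A)=\pi(2a-A)$ for every Borel set $A$, where $2a-A:=\{2a-x\mid x\in A\}$. **Location--scale family.** The location--scale family generated by $\mathbb Q_0\in\mathcal P$ consists of the pushforwards $\mathbb Q_{\nu,S}:=(T_{\nu,S})_\#\mathbb Q_0$, where $T_{\nu,S}(x):=\nu+S^{1/2}x$, for $\nu\in\mathbb R^d$, $S\in\mathcal S_{++}^d$. Here $T_\#\pi(A):=\pi(T^{-1}(A))$.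 **$f$-divergence.** Let $f\colon\mathbb R_{>0}\to\mathbb R$ be convex with $f(1)=0$, extended by $f(0):=\lim_{t\downarrow0}f(t)$ and $f'(\infty):=\lim_{t\downarrow0}t f(1/t)$ (both possibly $+\infty$). For probability measures $\mathbb P,\mathbb Q$ and any $\sigma$-finite measure $\lambda$ dominating both, with densities $p=d\mathbb P/d\lambda$, $q=d\mathbb Q/d\lambda$, $$\mathcal D_f(\mathbb P\|\mathbb Q):=\int_{\{q>0\}}q\,f(p/q)\,d\lambda+f'(\infty)\,\mathbb P(\{q=0\})\in[0,\infty],\qquad 0\cdot\infty:=0.$$ *)

(* Defs.v *)
From HB Require Import structures.
From mathcomp Require Import all_boot all_order all_algebra.
From mathcomp Require Import all_classical all_reals all_analysis.
From mathcomp Require Import measurable_realfun ring lra.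

Set Implicit Arguments.
Unset Strict Implicit.
Unset Printing Implicit Defensive.

Import Order.TTheory GRing.Theory Num.Theory.
Import numFieldTopology.Exports numFieldNormedType.Exports.

Local Open Scope classical_set_scope.
Local Open Scope ring_scope.

(* The Borel sigma-algebra of the (product) topology of matrices; R^d is
   'cV[R]_d. *)
HB.instance Definition _ (R : realType) (m n : nat) :=
  @isMeasurable.Build (sigma_display (@open 'M[R]_(m, n))) 'M[R]_(m, n)
    <<s @open 'M[R]_(m, n) >> (@sigma_algebra0 _ setT _)
    (@sigma_algebraC _ _) (@sigma_algebra_bigcup _ setT _).

Lemma mulmx_continuous (R : realType) (m n p : nat) (B : 'M[R]_(m, n)) :
  continuous (fun x : 'M[R]_(n, p) => B *m x).
Proof.
move=> x A [U Ux UA].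
have BxU i j : \forall y \near x, U i j ((B *m y) i j).
  suff: (B *m y) i j @[y --> x] --> (B *m x) i j by apply; exact: Ux.
  rewrite mxE; under eq_fun do rewrite mxE.
  apply: (@cvg_big _ _ _ _ _ _ _ _ _ _ _ (nbhs_filter x)) => [|k _].
    exact: add_continuous.
  by apply: cvgM; [exact: cvg_cst|exact: coord_continuous].
have := @filter_forall _ _ _ _ (nbhs_filter x)
  (fun i => @filter_forall _ _ _ _ (nbhs_filter x) (BxU i)).
by apply: filterS => y; exact: UA.
Qed.

Lemma continuous_measurable_mx (R : realType) (m n p q : nat)
    (f : 'M[R]_(m, n) -> 'M[R]_(p, q)) :
  continuous f -> measurable_fun setT f.
Proof.
move=> /continuousP cf; apply: (measurability (@open 'M[R]_(p, q))) => //.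
move=> _ [B oB <-]; rewrite setTI; apply: sub_sigma_algebra; exact: cf.
Qed.

Definition posdefmx (R : realType) (d : nat) (S : 'M[R]_d) : Prop :=
  S^T = S /\ forall x : 'cV[R]_d, x != 0 -> 0 < (x^T *m S *m x) 0 0.

(* The positive definite square root; it exists and is unique when S is
   positive definite. *)
Definition sqrtmx (R : realType) (d : nat) (S : 'M[R]_d) : 'M[R]_d :=
  get [set B | posdefmx B /\ B *m B = S].

Definition loc_scale_map (R : realType) (d : nat) (nu : 'cV[R]_d)
    (S : 'M[R]_d) : 'cV[R]_d -> 'cV[R]_d :=
  fun x => nu + sqrtmx S *m x.

Lemma measurable_loc_scale_map (R : realType) (d : nat) (nu : 'cV[R]_d)
    (S : 'M[R]_d) : measurable_fun setT (loc_scale_map nu S).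
Proof.
apply: continuous_measurable_mx => x.
by apply: (@cvgD _ _ _ _ (nbhs_filter x));
  [exact: cvg_cst|exact: mulmx_continuous].
Qed.

HB.instance Definition _ (R : realType) (d : nat) (nu : 'cV[R]_d)
    (S : 'M[R]_d) :=
  isMeasurableFun.Build _ _ _ _ (loc_scale_map nu S)
    (measurable_loc_scale_map nu S).

Definition loc_scale (R : realType) (d : nat) (Q0 : probability 'cV[R]_d R)
    (nu : 'cV[R]_d) (S : 'M[R]_d) : probability 'cV[R]_d R :=
  distribution Q0 (loc_scale_map nu S).

Definition even_symmetric (R : realType) (d : nat) (a : 'cV[R]_d)
    (pi : probability 'cV[R]_d R) : Prop :=
  forall A : set 'cV[R]_d, measurable A ->
    pi A = pi [set a *+ 2 - x | x in A].

(* `|x| is the sup norm of 'cV[R]_d; all norms of R^d are equivalent. *)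
Definition finite_first_moment (R : realType) (d : nat)
    (pi : probability 'cV[R]_d R) : Prop :=
  (\int[pi]_x `|x|%:E < +oo)%E.

Definition mean (R : realType) (d : nat)
    (pi : probability 'cV[R]_d R) : 'cV[R]_d :=
  \col_i \int[pi]_x x i 0.

Section f_divergence.
Context {R : realType}.
Local Open Scope ereal_scope.

(* f : R -> R only matters on positive reals. *)
Definition f_zero (f : R -> R) : \bar R := lim ((f t)%:E @[t --> 0^'+]).

Definition f_slope_oo (f : R -> R) : \bar R :=
  lim ((t * f t^-1)%:E @[t --> 0^'+]).

Definition f_ext (f : R -> R) (t : R) : \bar R :=
  if (0 < t)%R then (f t)%:E else f_zero f.

Context {disp : measure_display} {T : measurableType disp}.

Definition is_density (la : {measure set T -> \bar R}) (P : probability T R)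
    (p : T -> R) : Prop :=
  [/\ measurable_fun setT p, forall x, (0 <= p x)%R &
      forall A, measurable A -> P A = \int[la]_(x in A) (p x)%:E].

Definition fdiv_wrt (f : R -> R) (P : probability T R)
    (la : {measure set T -> \bar R}) (p q : T -> R) : \bar R :=
  \int[la]_(x in [set x | (0 < q x)%R]) ((q x)%:E * f_ext f (p x / q x)) +
  f_slope_oo f * P [set x | q x = 0%R].

Definition is_fdiv (f : R -> R) (P Q : probability T R) (v : \bar R) : Prop :=
  forall (la : {sigma_finite_measure set T -> \bar R}) (p q : T -> R),
    P `<< la -> Q `<< la -> is_density la P p -> is_density la Q q ->
    v = fdiv_wrt f P la p q.

Definition fdiv (f : R -> R) (P Q : probability T R) : \bar R :=
  get [set v | is_fdiv f P Q v].

End f_divergence.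

Section f_divergence_theory.
Context {R : realType} {disp : measure_display} {T : measurableType disp}.
Implicit Types (P Q : probability T R)
  (la : {sigma_finite_measure set T -> \bar R}) (p q : T -> R).

Lemma measurable_convex_pos (f : R -> R) :
  convex_function (`]0, +oo[%classic : set R) (f : R -> R^o) ->
  measurable_fun (`]0, +oo[%classic : set R) f.
Proof.
move=> cf.
apply: (measurability _ (RGenInftyO.measurableE R)) => //.
move=> _ [_ [c ->] <-]; apply: is_interval_measurable => x y.
move=> [/= x0 fx] [/= y0 fy] z /andP[xz zy].
move: x0 y0 fx fy; rewrite !in_itv/= !andbT => x0 y0 fx fy.
have z0 : 0 < z by apply: lt_le_trans x0 xz.
split=> //.
have [xy|yx] := ltP x y; last first.
  have -> // : z = x by apply/eqP; rewrite eq_le xz (le_trans zy).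
pose t := (y - z) / (y - x).
have yx0 : 0 < y - x by rewrite subr_gt0.
have t0 : 0 <= t by rewrite divr_ge0 ?subr_ge0// ltW.
have t1 : t <= 1 by rewrite ler_pdivrMr// mul1r lerB.
have fz : f (t * x + (1 - t) * y) <= t * f x + (1 - t) * f y.
  by apply: (cf (Itv01 t0 t1)); rewrite inE/= in_itv/= ?x0 ?y0.
have tz : t * x + (1 - t) * y = z by rewrite /t; field; rewrite gt_eqF.
rewrite /= -tz (le_lt_trans fz)//.
have [->|tn0] := eqVneq t 0; first by rewrite mul0r add0r subr0 mul1r.
have tp : 0 < t by rewrite lt_def tn0.
rewrite (_ : c = t * c + (1 - t) * c); last by ring.
by rewrite ltr_leD// ?ltr_pM2l// ler_wpM2l ?subr_ge0// ltW.
Qed.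

Lemma measurable_f_ext (f : R -> R) :
  convex_function (`]0, +oo[%classic : set R) (f : R -> R^o) ->
  measurable_fun setT (f_ext f).
Proof.
move=> cf; apply: measurable_fun_if => //.
- exact: measurable_fun_ltr.
- rewrite setTI (_ : _ @^-1` _ = `]0, +oo[%classic :> set R); last first.
    by apply/seteqP; split => x /=; rewrite in_itv/= andbT.
  by apply/measurable_EFinP; exact: measurable_convex_pos.
Qed.

Lemma measurable_ratio p q : measurable_fun setT p -> measurable_fun setT q ->
  (forall x, 0 <= q x)%R -> measurable_fun setT (fun x => p x / q x).
Proof.
move=> mp mq q0; apply: measurable_funM => //.
rewrite (_ : (fun x => (q x)^-1) = (fun x => q x `^ (-1))).
  exact: (measurableT_comp (@measurable_powR R (-1)) mq).
by apply/funext => x; rewrite powR_inv1.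
Qed.

Local Open Scope ereal_scope.

Lemma ge0_integral_density la Q q (h : T -> \bar R) (D : set T) :
  Q `<< la -> is_density la Q q -> measurable D -> measurable_fun D h ->
  (forall x, 0 <= h x) ->
  \int[la]_(x in D) ((q x)%:E * h x) = \int[Q]_(x in D) h x.
Proof.
move=> Qla [mq q0 Qq] mD mh h0.
have mf := Radon_Nikodym_SigmaFinite.f_integrable Qla.
rewrite -(Radon_Nikodym_SigmaFinite.change_of_variables Qla h0 mD mh).
under [LHS]eq_integral do rewrite muleC.
apply: ae_eq_integral => //.
- apply: emeasurable_funM => //; apply/measurable_EFinP.
  exact: measurable_funTS.
- apply: emeasurable_funM => //.
  exact/measurable_funTS/measurable_int/mf.
- apply: ae_eqe_mul2l.
  apply: ae_eq_sym; apply: integral_ae_eq => //.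
  + exact: integrableS mf.
  + by apply/measurable_EFinP; exact: measurable_funTS.
  + move=> E _ mE; rewrite -Qq//; symmetry.
    exact: (Radon_Nikodym_SigmaFinite.f_integral Qla).
Qed.

Lemma integral_density la Q q (h : T -> \bar R) (D : set T) :
  Q `<< la -> is_density la Q q -> measurable D -> measurable_fun D h ->
  \int[la]_(x in D) ((q x)%:E * h x) = \int[Q]_(x in D) h x.
Proof.
move=> Qla dQ mD mh; have [_ q0 _] := dQ.
rewrite integralE [RHS]integralE; congr (_ - _).
- rewrite -(ge0_integral_density Qla dQ mD)//; last exact: measurable_funepos.
  apply: eq_integral => x _; rewrite !funeposE.
  by rewrite maxe_pMr ?lee_fin// mule0.
- rewrite -(ge0_integral_density Qla dQ mD)//; last exact: measurable_funeneg.
  apply: eq_integral => x _; rewrite !funenegE.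
  by rewrite maxe_pMr ?lee_fin// mule0 muleN.
Qed.

Lemma measurable_pos q : measurable_fun setT q ->
  measurable [set x | (0 < q x)%R].
Proof.
move=> mq; rewrite (_ : [set _ | _] = q @^-1` `]0%R, +oo[); last first.
  by apply/seteqP; split => x /=; rewrite in_itv/= andbT.
by rewrite -[X in measurable X]setTI; exact: mq.
Qed.

Lemma density_pos_ae la Q q : is_density la Q q ->
  Q (~` [set x | (0 < q x)%R]) = 0.
Proof.
move=> [mq q0 Qq]; have mD := measurable_pos mq.
rewrite Qq; last exact: measurableC.
apply: integral0_eq => x /= /negP; rewrite -leNgt => qx.
by congr EFin; apply/eqP; rewrite eq_le qx q0.
Qed.

Lemma integral_ratio la P Q p q (E : set T) :
  Q `<< la -> is_density la P p -> is_density la Q q -> measurable E ->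
  \int[Q]_(x in E) (p x / q x)%:E = P (E `&` [set x | (0 < q x)%R]).
Proof.
move=> Qla [mp p0 Pp] dQ mE; have [mq q0 _] := dQ.
have mD := measurable_pos mq.
rewrite -(integral_density Qla dQ mE); last first.
  by apply/measurable_EFinP/measurable_funTS; exact: measurable_ratio.
rewrite Pp; last exact: measurableI.
rewrite integral_mkcondr; apply: eq_integral => x _.
rewrite patchE; case: ifPn; rewrite ?notin_setE ?inE/=.
  by move=> qx; rewrite -EFinM mulrCA divff ?mulr1// gt_eqF.
move=> /negP; rewrite -leNgt => qx.
by rewrite (_ : q x = 0%R) ?mul0e//; apply/eqP; rewrite eq_le qx q0.
Qed.

Lemma density_pos_null P Q la1 la2 q1 q2 :
  P `<< la1 -> is_density la1 Q q1 -> is_density la2 Q q2 ->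
  P ([set x | (0 < q1 x)%R] `\` [set x | (0 < q2 x)%R]) = 0.
Proof.
move=> Pla1 dQ1 dQ2; have [mq1 q10 Qq1] := dQ1; have [mq2 _ _] := dQ2.
set N := _ `\` _.
have mN : measurable N by apply: measurableD; exact: measurable_pos.
have QN : Q N = 0.
  by apply: (subset_measure0 _ _ _ (density_pos_ae dQ2)) => //;
    [exact/measurableC/measurable_pos|move=> x []].
suff laN : la1 N = 0.
  by move/null_content_dominatesP : Pla1; apply.
have /(ae_eq_integral_abs la1 mN) : \int[la1]_(x in N) `|(q1 x)%:E| = 0.
  by under eq_integral do rewrite gee0_abs ?lee_fin//; rewrite -Qq1.
move=> /(_ _)[|A [mA A0 NA]].
  by apply/measurable_EFinP; exact: measurable_funTS.
apply: (subset_measure0 _ _ _ A0) => // x Nx; apply: NA => /= /(_ Nx)[].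
by case: Nx => /= /lt0r_neq0/eqP.
Qed.

Lemma fdiv_wrt_indep (f : R -> R) P Q la1 la2 p1 q1 p2 q2 :
  convex_function (`]0%R, +oo[%classic : set R) (f : R -> R^o) ->
  P `<< la1 -> Q `<< la1 -> is_density la1 P p1 -> is_density la1 Q q1 ->
  P `<< la2 -> Q `<< la2 -> is_density la2 P p2 -> is_density la2 Q q2 ->
  fdiv_wrt f P la1 p1 q1 = fdiv_wrt f P la2 p2 q2.
Proof.
move=> cf Pla1 Qla1 dP1 dQ1 Pla2 Qla2 dP2 dQ2.
have [mp1 p10 _] := dP1; have [mp2 p20 _] := dP2.
have [mq1 q10 _] := dQ1; have [mq2 q20 _] := dQ2.
have mD1 := measurable_pos mq1; have mD2 := measurable_pos mq2.
have N12 := density_pos_null Pla1 dQ1 dQ2.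
have N21 := density_pos_null Pla2 dQ2 dQ1.
have Q1 := density_pos_ae dQ1; have Q2 := density_pos_ae dQ2.
set D1 := [set x | (0 < q1 x)%R] in mD1 N12 N21 Q1 *.
set D2 := [set x | (0 < q2 x)%R] in mD2 N12 N21 Q2 *.
have PD E : measurable E -> P (E `&` D1) = P (E `&` D2).
  move=> mE.
  have aux A B : measurable A -> measurable B -> P (A `\` B) = 0 ->
      P (E `&` A) = P (E `&` A `&` B).
    move=> mA mB AB0.
    rewrite (measureDI P (measurableI _ _ mE mA) mB).
    rewrite [X in X + _](_ : _ = 0) ?add0e//.
    apply: (subset_measure0 _ _ _ AB0); [..|by move=> x [[]]].
    - by apply: measurableD => //; exact: measurableI.
    - exact: measurableD.
  by rewrite (aux _ _ mD1 mD2 N12) (aux _ _ mD2 mD1 N21) setIAC.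
have mr1 := measurable_ratio mp1 mq1 q10.
have mr2 := measurable_ratio mp2 mq2 q20.
have r12 : ae_eq Q setT (fun x => (p1 x / q1 x)%:E) (fun x => (p2 x / q2 x)%:E).
  apply: integral_ae_eq => //.
  - apply/integrableP; split; first exact/measurable_EFinP.
    under eq_integral do rewrite gee0_abs ?lee_fin ?divr_ge0//.
    rewrite (integral_ratio Qla1 dP1 dQ1)//.
    by rewrite (le_lt_trans (probability_le1 _ _))// ?ltry//;
      exact: measurableI.
  - exact/measurable_EFinP.
  - move=> E _ mE.
    by rewrite (integral_ratio Qla1 dP1 dQ1)//
      (integral_ratio Qla2 dP2 dQ2)// PD.
rewrite /fdiv_wrt; congr (_ + _).
  have mfe p q : measurable_fun setT (fun x => p x / q x)%R ->
      measurable_fun setT (fun x => f_ext f (p x / q x)).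
    by move=> m; apply: measurableT_comp (measurable_f_ext cf) m.
  have mf1 := mfe _ _ mr1; have mf2 := mfe _ _ mr2.
  rewrite (integral_density Qla1 dQ1)//; last by exact: measurable_funTS.
  rewrite (integral_density Qla2 dQ2)//; last by exact: measurable_funTS.
  rewrite integral_mkcond [RHS]integral_mkcond.
  apply: ae_eq_integral => //.
  - by apply/(measurable_restrictT _ mD1); exact: measurable_funTS.
  - by apply/(measurable_restrictT _ mD2); exact: measurable_funTS.
  - have D1ae : {ae Q, forall x, D1 x}.
      by exists (~` D1); split => //; exact: measurableC.
    have D2ae : {ae Q, forall x, D2 x}.
      by exists (~` D2); split => //; exact: measurableC.
    apply: filterS3 r12 D1ae D2ae => x /= r12 D1x D2x _.
    rewrite !patchE !mem_set//.
    by have [->] := r12 Logic.I.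
congr (_ * _).
have PC q : (forall x, 0 <= q x)%R ->
    [set x | q x = 0%R] = ~` [set x | (0 < q x)%R].
  move=> q0; apply/seteqP; split => x /=; first by move=> ->; rewrite ltxx.
  by move=> /negP; rewrite -leNgt => qx; apply/eqP; rewrite eq_le qx q0.
rewrite !PC// !probability_setC//; congr (_ - _).
by have := PD _ measurableT; rewrite !setTI.
Qed.

(* By fdivE and ex_densities, fdiv f P Q is the common value of fdiv_wrt over
   all sigma-finite la dominating P and Q. *)
Lemma fdivE (f : R -> R) P Q la p q :
  convex_function (`]0%R, +oo[%classic : set R) (f : R -> R^o) ->
  P `<< la -> Q `<< la -> is_density la P p -> is_density la Q q ->
  fdiv f P Q = fdiv_wrt f P la p q.
Proof.
move=> cf Pla Qla dP dQ.
have : is_fdiv f P Q (fdiv f P Q).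
  apply: (@getPex _ (is_fdiv f P Q)); exists (fdiv_wrt f P la p q).
  move=> la' p' q' Pla' Qla' dP' dQ'.
  exact: (fdiv_wrt_indep cf Pla Qla dP dQ Pla' Qla' dP' dQ').
exact.
Qed.

Lemma ex_densities P Q :
  exists (la : {sigma_finite_measure set T -> \bar R}) (p q : T -> R),
    [/\ P `<< la, Q `<< la, is_density la P p & is_density la Q q].
Proof.
pose la0 : {measure set T -> \bar R} := measure_add P Q.
have la0E A : la0 A = P A + Q A by exact: measure_addE.
have la0_fin : fin_num_fun la0.
  by move=> A mA; rewrite la0E fin_numD !fin_num_measure.
pose la : {finite_measure set T -> \bar R} :=
  HB.pack (Measure.sort la0)
    (Measure_isFinite.Build _ _ _ (Measure.sort la0) la0_fin).
have dom (M : probability T R) : (forall A, M A <= la A) -> M `<< la.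
  move=> Mla; apply/null_content_dominatesP => A mA laA.
  by apply/eqP; rewrite -measure_le0 -laA; exact: Mla.
have Pla : P `<< la by apply: dom => A; rewrite la0E leeDl.
have Qla : Q `<< la by apply: dom => A; rewrite la0E leeDr.
have dens (M : probability T R) : M `<< la -> exists p, is_density la M p.
  move=> Mla; exists (fine \o Radon_Nikodym_SigmaFinite.f M la); split.
  - apply/measurableT_comp/measurable_int => //.
    exact: (Radon_Nikodym_SigmaFinite.f_integrable Mla).
  - by move=> x; rewrite fine_ge0// Radon_Nikodym_SigmaFinite.f_ge0.
  - move=> A mA; rewrite (Radon_Nikodym_SigmaFinite.f_integral Mla mA).
    apply: eq_integral => x _ /=.
    by rewrite fineK// Radon_Nikodym_SigmaFinite.f_fin_num.
have [p dp] := dens _ Pla; have [q dq] := dens _ Qla.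
by exists la, p, q.
Qed.

End f_divergence_theory.

Definition argmins {T : Type} {R : realType} (D : set T) (g : T -> \bar R) :
  set T := [set x | D x /\ forall y, D y -> (g x <= g y)%E].

(* Main.v *)
(** The reflection x |-> 2m - x is a Borel involution that fixes P and, by the
    symmetry of Q0, sends the law Q_(nu,S) to Q_(2m-nu,S). An f-divergence is
    invariant under bimeasurable bijections, so (2m - nu, S) is a minimiser
    whenever (nu, S) is; uniqueness forces nu = m. The mean of an even
    symmetric law is its centre, and Q_(nu,S) is even symmetric about nu. *)

Require Import Defs.
From HB Require Import structures.
From mathcomp Require Import all_boot all_order all_algebra.
From mathcomp Require Import all_classical all_reals all_analysis.
From mathcomp Require Import measurable_realfun lra.

Set Implicit Arguments.
Unset Strict Implicit.
Unset Printing Implicit Defensive.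

Import Order.TTheory GRing.Theory Num.Theory.
Import numFieldTopology.Exports numFieldNormedType.Exports.

Local Open Scope classical_set_scope.
Local Open Scope ring_scope.

Lemma measurable_preimage (d d' : measure_display) (T : measurableType d)
    (T' : measurableType d') (phi : {mfun T >-> T'}) (A : set T') :
  measurable A -> measurable (phi @^-1` A).
Proof.
by move=> mA; rewrite -[X in measurable X]setTI; exact: measurable_funP.
Qed.

(** * Invariance of f-divergences under injective changes of variables *)

Section f_divergence_pushforward.
Context {R : realType} {d d' : measure_display}
  {T : measurableType d} {T' : measurableType d'}.
Local Open Scope ereal_scope.

(** The integrand of an f-divergence may change sign and fail to be integrable. As the integral is
    the difference of those of the positive and negative parts, the nonnegative change of variables
    applies to each. *)
Lemma integral_pushforward_measurable (la : {measure set T -> \bar R})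
    (phi : {mfun T >-> T'}) (D : set T') (h : T' -> \bar R) :
  measurable D -> measurable_fun D h ->
  \int[pushforward la phi]_(y in D) h y =
  \int[la]_(x in phi @^-1` D) h (phi x).
Proof.
move=> mD mh; transitivity (\int[la]_(x in phi @^-1` D) (h \o phi) x) => //.
rewrite [LHS]integralE [RHS]integralE (funepos_comp h phi) (funeneg_comp h phi).
by congr (_ - _); apply: ge0_integral_pushforward => //;
  [exact: measurable_funepos | exact: measurable_funeneg].
Qed.

Lemma sigma_finite_pushforward (la : {sigma_finite_measure set T -> \bar R})
    (phi : {mfun T >-> T'}) (psi : {mfun T' >-> T}) :
  cancel phi psi -> sigma_finite setT (pushforward la phi).
Proof.
move=> phiK; have [F FT Ffin] := sigma_finiteT la.
exists (fun n => psi @^-1` F n); first by rewrite -preimage_bigcup -FT.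
move=> n; have [mF laF] := Ffin n; split; first exact: measurable_preimage.
rewrite /pushforward -comp_preimage (_ : psi \o phi = id)//.
by apply/funext => x /=; rewrite phiK.
Qed.

(** If [p] and [q] are densities with respect to [la], then [p \o psi] and [q \o psi] are densities
    of the image laws with respect to the pushforward of [la]; changing variables and cancelling
    [psi] against [phi] restores the original formula. *)
Lemma fdiv_pushforward (f : R -> R) (P Q : probability T R)
    (P' Q' : probability T' R) (phi : {mfun T >-> T'}) (psi : {mfun T' >-> T}) :
  convex_function (`]0%R, +oo[%classic : set R) (f : R -> R^o) ->
  cancel phi psi ->
  (forall A, measurable A -> P' A = P (phi @^-1` A)) ->
  (forall A, measurable A -> Q' A = Q (phi @^-1` A)) ->
  fdiv f P' Q' = fdiv f P Q.
Proof.
move=> cf phiK P'E Q'E.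
have [la [p [q [Pla Qla dP dQ]]]] := ex_densities P Q.
have sfla := sigma_finite_pushforward la phiK.
(* [pose] abstracts over the unresolved measurability proof of [phi]. *)
pose push : {measure set T' -> \bar R} := pushforward la phi.
pose la0 := push (measurable_funPT phi).
pose la' : {sigma_finite_measure set T' -> \bar R} :=
  HB.pack (Measure.sort la0)
    (Measure_isSigmaFinite.Build _ _ _ (Measure.sort la0) sfla).
have dom (M : probability T R) (M' : probability T' R) :
    (forall A, measurable A -> M' A = M (phi @^-1` A)) ->
    M `<< la -> M' `<< la'.
  move=> M'E /null_content_dominatesP Mla; apply/null_content_dominatesP.
  move=> A mA laA; rewrite M'E//; apply: Mla => //.
  exact: measurable_preimage.
have dens (M : probability T R) (M' : probability T' R) (g : T -> R) :
    (forall A, measurable A -> M' A = M (phi @^-1` A)) ->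
    is_density la M g -> is_density la' M' (g \o psi).
  move=> M'E [mg g0 Mg]; split.
  - exact: measurableT_comp.
  - by move=> x /=; exact: g0.
  - move=> A mA; rewrite M'E// Mg; last exact: measurable_preimage.
    rewrite integral_pushforward_measurable//.
      by apply: eq_integral => x _ /=; rewrite phiK.
    by apply/measurable_EFinP/measurable_funTS; exact: measurableT_comp.
have dP' := dens _ _ _ P'E dP; have dQ' := dens _ _ _ Q'E dQ.
rewrite (fdivE cf Pla Qla dP dQ).
rewrite (fdivE cf (dom _ _ P'E Pla) (dom _ _ Q'E Qla) dP' dQ').
have [mp' p'0 _] := dP'; have [mq' q'0 _] := dQ'.
rewrite /fdiv_wrt; congr (_ + _ * _).
  rewrite integral_pushforward_measurable/=; first last.
  - apply/measurable_funTS/emeasurable_funM; first exact/measurable_EFinP.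
    apply: measurableT_comp (measurable_f_ext cf) _.
    exact: measurable_ratio.
  - exact: measurable_pos.
  under eq_integral do rewrite phiK.
  by congr integral; apply/seteqP; split => x /=; rewrite phiK.
rewrite P'E.
  by congr (P _); apply/seteqP; split => x /=; rewrite phiK.
rewrite (_ : [set _ | _] = (q \o psi) @^-1` [set 0%R])//.
by rewrite -[X in measurable X]setTI; exact: mq'.
Qed.

End f_divergence_pushforward.

(** * Point reflections and symmetric laws *)

Section reflection.
Context {R : realType} {d : nat}.
Implicit Types (a m nu : 'cV[R]_d) (S : 'M[R]_d) (P Q : probability 'cV[R]_d R).

Definition reflect_mx a : 'cV[R]_d -> 'cV[R]_d := fun x => a *+ 2 - x.

Lemma measurable_reflect_mx a : measurable_fun setT (reflect_mx a).
Proof.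
apply: continuous_measurable_mx => x.
by apply: (@cvgB _ _ _ _ (nbhs_filter x)); [exact: cvg_cst|exact: cvg_id].
Qed.

HB.instance Definition _ a :=
  isMeasurableFun.Build _ _ _ _ (reflect_mx a) (measurable_reflect_mx a).

Lemma reflect_mxK a : involutive (reflect_mx a).
Proof. by move=> x; rewrite /reflect_mx opprB addrC subrK. Qed.

(** Images and preimages under an involution coincide, so even symmetry becomes invariance under a
    pushforward. *)
Lemma reflect_mx_image a (A : set 'cV[R]_d) :
  [set a *+ 2 - x | x in A] = reflect_mx a @^-1` A.
Proof.
apply/seteqP; split => [_ [x Ax <-]|x Ax]; first by rewrite /= reflect_mxK.
by exists (reflect_mx a x) => //; exact: (reflect_mxK a).
Qed.

Lemma even_symmetric_preimage a P : even_symmetric a P ->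
  forall A, measurable A -> P A = P (reflect_mx a @^-1` A).
Proof. by move=> Psym A mA; rewrite -reflect_mx_image; exact: Psym. Qed.

Lemma loc_scaleE nu S Q (A : set 'cV[R]_d) :
  loc_scale Q nu S A = Q (loc_scale_map nu S @^-1` A).
Proof. by []. Qed.

(** With [B] the square root of [S], 2m - (nu + Bx) = (2m - nu) + B(-x), and x |-> -x preserves
    [Q]. *)
Lemma loc_scale_reflect m nu S Q : even_symmetric 0 Q ->
  forall A, measurable A ->
  loc_scale Q (reflect_mx m nu) S A = loc_scale Q nu S (reflect_mx m @^-1` A).
Proof.
move=> Qsym A mA; rewrite !loc_scaleE.
rewrite (even_symmetric_preimage Qsym); last exact: measurable_preimage.
congr (Q _); apply/seteqP; split => x /=;
  by rewrite /loc_scale_map /reflect_mx mul0rn sub0r mulmxN opprD addrA.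
Qed.

(** The case [m = nu] of the previous lemma, since [nu] is fixed by its own reflection. *)
Lemma even_symmetric_loc_scale nu S Q : even_symmetric 0 Q ->
  even_symmetric nu (loc_scale Q nu S).
Proof.
move=> Qsym A mA; rewrite reflect_mx_image -loc_scale_reflect//.
by rewrite (_ : reflect_mx nu nu = nu)// /reflect_mx mulr2n addrK.
Qed.

(** * Integrability of coordinates and means *)

Lemma continuous_measurable_mxR (g : 'cV[R]_d -> R) :
  continuous g -> measurable_fun setT g.
Proof.
move=> /continuousP cg.
apply: (measurability _ (RGenOpens.measurableE R)) => //.
move=> _ [_ [a [b ->]] <-]; rewrite setTI; apply: sub_sigma_algebra.
by apply: cg; exact: interval_open.
Qed.

Lemma measurable_coord (i : 'I_d) :
  measurable_fun setT (fun x : 'cV[R]_d => x i 0).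
Proof. by apply: continuous_measurable_mxR; exact: coord_continuous. Qed.

Lemma coord_integrable P (i : 'I_d) : finite_first_moment P ->
  P.-integrable setT (fun x => (x i 0)%:E).
Proof.
move=> Pfin; have mi := measurable_coord i.
apply/integrableP; split; first exact/measurable_EFinP.
apply: le_lt_trans Pfin; apply: ge0_le_integral => //.
- by apply/measurableT_comp => //; exact/measurable_EFinP.
- apply/measurable_EFinP; apply: (@continuous_measurable_mxR Num.norm).
  exact: norm_continuous.
- move=> x _; rewrite lee_fin [leRHS]/Num.norm/= mx_normrE.
  exact: (le_bigmax _ (fun ij => `|x ij.1 ij.2|) (i, 0)).
Qed.

(** Pulled back to [Q], the coordinate is a constant plus a finite linear combination of
    coordinates. *)
Lemma loc_scale_coord_integrable Q nu S (i : 'I_d) : finite_first_moment Q ->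
  (loc_scale Q nu S).-integrable setT (fun x => (x i 0)%:E).
Proof.
move=> Qfin.
have intQ : Q.-integrable setT (fun x => (loc_scale_map nu S x i 0)%:E).
  rewrite (_ : (fun _ => _) = (EFin \o cst (nu i 0%R)) \+
      (fun x : 'cV[R]_d => \sum_j (sqrtmx S i j)%:E * (x j 0%R)%:E))%E;
      last first.
    by apply/funext => x /=; rewrite /loc_scale_map !mxE EFinD -sumEFin.
  apply: integrableD => //; first exact: finite_measure_integrable_cst.
  apply: integrable_sum => // j _.
  by apply: integrableZl => //; exact: coord_integrable.
apply: integrable_pushforward => //.
apply/measurable_EFinP; exact: measurable_coord.
Qed.

(** Reflecting the variable shows that each coordinate mean c satisfies c = 2 a_i - c; integrability
    allows the integral to be split. *)
Lemma mean_even_symmetric a P :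
  (forall i, P.-integrable setT (fun x => (x i 0)%:E)) ->
  even_symmetric a P -> mean P = a.
Proof.
move=> intP Psym; apply/matrixP => i j; rewrite ord1 mxE {j}.
have mi := measurable_coord i.
have : \int[P]_x x i 0 = (a i 0) *+ 2 - \int[P]_x x i 0.
  have cst_int : P.-integrable setT (EFin \o cst (a i 0 *+ 2)).
    exact: finite_measure_integrable_cst.
  (* The constant 2 a_i is written as its own integral, using that [P] has total mass 1, so that the
     right side becomes a single integral. *)
  rewrite -[X in X - _]mulr1 -[1]/(fine 1%E) -(@probability_setT _ _ _ P).
  rewrite -Rintegral_cst// -RintegralB//; last exact: intP.
  congr fine; transitivity (\int[pushforward P (reflect_mx a)]_x (x i 0)%:E)%E.
    by apply: eq_measure_integral => A mA _; exact: even_symmetric_preimage.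
  rewrite integral_pushforward_measurable ?preimage_setT//; last first.
    exact/measurable_EFinP.
  by apply: eq_integral => x _; rewrite !mxE mulr2n.
lra.
Qed.

End reflection.

Theorem corollary4p3 (R : realType) (d : nat) (d_ge1 : (1 <= d)%N)
    (f : R -> R)
    (f_convex : convex_function (`]0, +oo[%classic : set R) (f : R -> R^o))
    (f_one : f 1 = 0)
    (m : 'cV[R]_d) (P : probability 'cV[R]_d R)
    (P_moment : finite_first_moment P) (P_sym : even_symmetric m P)
    (Q0 : probability 'cV[R]_d R)
    (Q0_moment : finite_first_moment Q0) (Q0_sym : even_symmetric 0 Q0)
    (nu : 'cV[R]_d) (S : 'M[R]_d)
    (unique_min :
      argmins [set z : 'cV[R]_d * 'M[R]_d | posdefmx z.2]
        (fun z => fdiv f P (loc_scale Q0 z.1 z.2)) = [set (nu, S)]) :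
  mean (loc_scale Q0 nu S) = mean P /\ mean P = m.
Proof.
have meanP : mean P = m.
  by apply: mean_even_symmetric P_sym => i; exact: coord_integrable.
have meanQ : mean (loc_scale Q0 nu S) = nu.
  apply: mean_even_symmetric => [i|]; first exact: loc_scale_coord_integrable.
  exact: even_symmetric_loc_scale.
suff mE : m = nu by rewrite meanQ meanP mE.
have [posS min_nu] : argmins [set z : 'cV[R]_d * 'M[R]_d | posdefmx z.2]
  (fun z => fdiv f P (loc_scale Q0 z.1 z.2)) (nu, S) by rewrite unique_min.
have : argmins [set z : 'cV[R]_d * 'M[R]_d | posdefmx z.2]
    (fun z => fdiv f P (loc_scale Q0 z.1 z.2)) (reflect_mx m nu, S).
  split => // z posz /=.
  (* The reflection about [m] preserves [P] and carries the law at [nu] to the law at its mirror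
     image, so both parameters have the same divergence. *)
  rewrite (_ : fdiv _ _ _ = fdiv f P (loc_scale Q0 nu S)); first exact: min_nu.
  apply: (@fdiv_pushforward _ _ _ _ _ _ _ _ _ _ (reflect_mx m)
      (reflect_mx m)) => //.
  - exact: reflect_mxK.
  - exact: even_symmetric_preimage.
  - exact: loc_scale_reflect.
(* Uniqueness gives 2m - nu = nu, which is halved entry by entry. *)
rewrite unique_min => -[/eqP]; rewrite subr_eq -mulr2n => /eqP /matrixP nuE.
by apply/matrixP => i j; have := nuE i j; rewrite !mulmxnE; lra.
Qed.
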